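(* Let $V$ be a finite-dimensional real vector space with linear coordinates $z_1,\dots,z_n$. Let $\mathfrak{A}\subset V^*$, with constants $h_\alpha$ ($\alpha\in\mathfrak A$) and $h$, be a $\bigvee$-system. Let $\mathfrak{A}^+$ be a positive subsystem, $\langle\cdot,\cdot\rangle$ the associated inner product on $V$, and $\langle\cdot,\cdot\rangle^*$ the dual inner product on $V^*$. Let $\widetilde V\cong\mathbb{R}\oplus V$ with coordinates $(x,\bm z)$. Let $\widetilde{\mathfrak{B}}\subset\widetilde V^*$ be a finite collection of covectors with non-zero component in the extended direction $\mathbb R$, normalised as $\widetilde{\mathfrak{B}}=\{(1,-\beta):\beta\in\mathfrak{B}\}$ with $\mathfrak{B}\subset V^*$, with corresponding constants $k_\beta$ satisfying the centre-of-mass condition $\sum_{\beta\in\mathfrak B}k_\beta\,\beta=0$. Put $$\overset{\star}{\mathscr F}_{\mathfrak A}(\bm z)=\tfrac12\sum_{\alpha\in\mathfrak A^+}h_\alpha\,\alpha(\bm z)^2\log\alpha(\bm z),\qquad \overset{\star}{\Omega}_{\widetilde{\mathfrak B}}(x,\bm z)=\sum_{\beta\in\mathfrak B}k_\beta\,(x-\beta(\bm z))\log(x-\beta(\bm z)).$$ Then $\overset{\star}{\mathscr F}_{\mathfrak A}$ and $\overset{\star}{\Omega}_{\widetilde{\mathfrak B}}$ satisfy the open WDVV equations if and only if the set $\{k_\beta,\ \beta\in\mathfrak B\}$ satisfies the following conditions for all $\beta_\circ\in\mathfrak B$: (i) The map $$\rho_{\beta_\circ}:\mathfrak A^+_{\beta_\circ}\longrightarrow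 \mathfrak B^{\bullet}_{\beta_\circ}/\!\sim,$$ sending $\alpha$ to the equivalence class of differences $\beta_\circ-\beta$ all elements of which define the same hyperplane $H_\alpha$ as $\alpha$, is a bijection. (ii) For every $\alpha\in\mathfrak A^+_{\beta_\circ}$, the residues along the hyperplane $H_\alpha$ satisfy $$\sum_{v\in\rho_{\beta_\circ}(\alpha)}k_v\,v=h_\alpha\,\langle\alpha,\beta_\circ\rangle^*\,\alpha ,$$ where $k_v:=k_\beta$ for $v=\beta_\circ-\beta$. (iii) The residues along the hyperplanes defined by elements of $\mathfrak B^{\circ}_{\beta_\circ}/\!\sim$ are zero: for every equivalence class $C\in\mathfrak B^{\circ}_{\beta_\circ}/\!\sim$, $$\sum_{\beta\,:\,\beta_\circ-\beta\in C}k_\beta\,(\beta-\beta_\circ)=0 .$$ In such a case, $\widetilde{\mathfrak B}$ (or, equivalently, $\mathfrak B$) is said to define an open $\bigvee$-system corresponding to the given (closed) $\bigvee$-system $\mathfrak A$.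
   Context: **$\bigvee$-system.** Let $V$ be a finite-dimensional real vector space and $\mathfrak A\subset V^*$ a finite collection of (non-zero) covectors such that $\alpha\in\mathfrak A\Rightarrow-\alpha\in\mathfrak A$, with constants $h_\alpha=h_{-\alpha}$ and a constant $h$. A positive subsystem $\mathfrak A^+$ contains exactly one of each pair $\pm\alpha$. The symmetric bilinear form $$\langle X,Y\rangle=\tfrac1{2h}\sum_{\alpha\in\mathfrak A}h_\alpha\,\alpha(X)\alpha(Y)$$ on $V$ is assumed non-degenerate; it is called the inner product, or metric, on $V$. It gives an isomorphism $V\to V^*$, $X\mapsto\langle X,\cdot\rangle$. For $\alpha\in V^*$ let $\alpha^\vee\in V$ be its preimage, and set $\langle\alpha,\beta\rangle^*:=\alpha(\beta^\vee)$ for $\alpha,\beta\in V^*$. The system $\mathfrak A$ is a $\bigvee$-system if for every $\alpha\in\mathfrak A$ and every two-plane $\Pi\subset V^*$ containing $\alpha$ there is $\lambda=\lambda(\Pi,\alpha)\in\mathbb R$ with $$\sum_{\beta\in\Pi\cap\mathfrak A}h_\beta\,\beta(\alpha^\vee)\,\beta^\vee=\lambda\,\alpha^\vee.$$ **Open WDVV equations.** Let $g_{\mu\nu}$ be the constant Gram matrix of $\langle\cdot,\cdot\rangle$ in the linear coordinates $z_1,\dots,z_n$ on $V$, and $g^{\mu\nu}$ its inverse. Given $\mathscr F(\bm z)$, set $$c^{\alpha}{}_{\mu\nu}=\sum_{\sigma}g^{\alpha\sigma}\frac{\partial^3\mathscr F}{\partial z_\sigma\partial z_\mu\partial z_\nu}.$$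 A pair $(\mathscr F(\bm z),\Omega(x,\bm z))$ satisfies the (rank-one) open WDVV equations if for all $\mu,\nu,\rho\in\{1,\dots,n\}$ $$\sum_{\alpha}c^\alpha{}_{\mu\nu}\frac{\partial^2\Omega}{\partial z_\alpha\partial z_\rho}+\frac{\partial^2\Omega}{\partial x\partial z_\rho}\frac{\partial^2\Omega}{\partial z_\mu\partial z_\nu}=\sum_\alpha c^\alpha{}_{\nu\rho}\frac{\partial^2\Omega}{\partial z_\alpha\partial z_\mu}+\frac{\partial^2\Omega}{\partial x\partial z_\mu}\frac{\partial^2\Omega}{\partial z_\nu\partial z_\rho},$$ $$\sum_\alpha c^\alpha{}_{\mu\nu}\frac{\partial^2\Omega}{\partial x\partial z_\alpha}+\frac{\partial^2\Omega}{\partial x^2}\frac{\partial^2\Omega}{\partial z_\mu\partial z_\nu}=\frac{\partial^2\Omega}{\partial x\partial z_\mu}\frac{\partial^2\Omega}{\partial x\partial z_\nu}.$$ **Hyperplanes and sets of differences.** For a non-zero covector $\alpha\in V^*$ let $H_\alpha=\{\bm z\in V:\alpha(\bm z)=0\}$. For non-zero covectors write $\alpha\sim\alpha'$ iff $H_\alpha=H_{\alpha'}$ (i.e. iff they are proportional). For $\beta_\circ\in\mathfrak B$ define $$\mathfrak A^+_{\beta_\circ}=\{\alpha\in\mathfrak A^+:\langle\alpha,\beta_\circ\rangle^*\neq0\},$$ $$\mathfrak B^\bullet_{\beta_\circ}=\{\beta_\circ-\beta:\ \beta\in\mathfrak B\setminus\{\beta_\circ\},\ \exists\,\alpha\in\mathfrak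 A^+_{\beta_\circ}\text{ with }\beta_\circ-\beta\sim\alpha\},$$ $$\mathfrak B^\circ_{\beta_\circ}=\{\beta_\circ-\beta:\ \beta\in\mathfrak B\setminus\{\beta_\circ\},\ \nexists\,\alpha\in\mathfrak A^+_{\beta_\circ}\text{ with }\beta_\circ-\beta\sim\alpha\}.$$ $\mathfrak B^\bullet_{\beta_\circ}/\!\sim$ and $\mathfrak B^\circ_{\beta_\circ}/\!\sim$ denote the sets of equivalence classes. ''Residues'' refers to the residues, along these hyperplanes, of the $V^*$-valued 1-forms obtained by differentiating the two sides of $$\sum_{\beta\in\mathfrak B\setminus\{\beta_\circ\}}k_\beta(\beta_\circ-\beta)\log[(\beta_\circ-\beta)(\bm z)]=\sum_{\alpha\in\mathfrak A^+}h_\alpha\,\alpha\,\langle\alpha,\beta_\circ\rangle^*\log[\alpha(\bm z)].$$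
   Formalization: The formal theorem additionally assumes that all constants h_α and k_β are non-zero and that distinct covectors of the positive subsystem are not proportional; without any one of these three the stated equivalence fails. *)

(* Defs.v *)
From HB Require Import structures.
From mathcomp Require Import all_boot all_order all_algebra finmap.
From mathcomp Require Import all_classical all_reals all_analysis.

Set Implicit Arguments.
Unset Strict Implicit.
Unset Printing Implicit Defensive.

Import Order.TTheory GRing.Theory Num.Theory.
Import numFieldNormedType.Exports.

Local Open Scope classical_set_scope.
Local Open Scope ring_scope.

(* In the linear coordinates z_1, ..., z_n the space V is 'cV[R]_n and its dual
   V^* is 'rV[R]_n.  Finite collections of covectors are finite sets {fset _};
   the constants h_a and k_b are functions on covectors of which only the
   values on the collection matter. *)

Section VeeSystems.
Context {R : realType} {n : nat}.
Implicit Types (a b v w : 'rV[R]_n) (X Y z : 'cV[R]_n).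

Definition pairing a X : R := (a *m X) 0 0.

Section Metric.
Variables (A : {fset 'rV[R]_n}) (hA : 'rV[R]_n -> R) (h : R).

Definition metric X Y : R :=
  (2 * h)^-1 * \sum_(a <- A) hA a * pairing a X * pairing a Y.

Definition gram : 'M[R]_n :=
  \matrix_(i, j) metric (delta_mx i 0) (delta_mx j 0).

Definition nondegenerate_metric : Prop :=
  forall X, (forall Y, metric X Y = 0) -> X = 0.

(* The preimage of a under X |-> metric X _ (see metric_dual_vector below);
   meaningful only when the metric is non-degenerate. *)
Definition dual_vector a : 'cV[R]_n := invmx gram *m a^T.

Definition dual_metric a b : R := pairing a (dual_vector b).

Record vee_system : Prop := VeeSystem {
  vee_neq0 : forall a, a \in A -> a != 0;
  vee_opp : forall a, a \in A -> - a \in A;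
  vee_const_opp : forall a, a \in A -> hA (- a) = hA a;
  vee_h_neq0 : h != 0;
  vee_nondegenerate : nondegenerate_metric;
  vee_condition : forall (a : 'rV[R]_n) (Pi : {vspace 'rV[R]_n}),
    a \in A -> \dim Pi = 2%N -> a \in Pi ->
    exists lambda : R,
      \sum_(b <- A | b \in Pi)
         (hA b * pairing b (dual_vector a)) *: dual_vector b
      = lambda *: dual_vector a }.

End Metric.

Definition positive_subsystem (A Ap : {fset 'rV[R]_n}) : Prop :=
  (Ap `<=` A)%fset /\ (forall a, a \in A -> (a \in Ap) (+) (- a \in Ap)).

Definition hyperplane a : set 'cV[R]_n := [set z | pairing a z = 0].

Definition same_hyperplane a b : bool := `[< hyperplane a = hyperplane b >].

Local Notation "a ~~~ b" := (same_hyperplane a b) (at level 70).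

Section Solutions.
Variables (Ap B : {fset 'rV[R]_n}) (hA k : 'rV[R]_n -> R).

(* The real logarithm ln `|u| stands for the (multivalued) log u.  Any other
   branch differs from it by a locally constant function of u, which affects
   neither the third derivatives of closed_prepotential nor the second
   derivatives of open_prepotential. *)
Definition closed_prepotential (z : 'cV[R]_n) : R :=
  2^-1 * \sum_(a <- Ap) hA a * pairing a z ^+ 2 * ln `|pairing a z|.

Definition open_prepotential (p : R * 'cV[R]_n) : R :=
  \sum_(b <- B) k b * (p.1 - pairing b p.2) * ln `|p.1 - pairing b p.2|.

Definition regular_points : set (R * 'cV[R]_n) :=
  [set p | (forall a, a \in Ap -> pairing a p.2 != 0) /\
           (forall b, b \in B -> p.1 - pairing b p.2 != 0)].

End Solutions.

Section OpenWDVV.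
Variables (g : 'M[R]_n) (F : 'cV[R]_n -> R) (Omega : R * 'cV[R]_n -> R).

Let e (i : 'I_n) : 'cV[R]_n := delta_mx i 0.
Let ez (i : 'I_n) : R * 'cV[R]_n := (0, e i).
Let ex : R * 'cV[R]_n := (1, 0).

Definition structure_const (alpha mu nu : 'I_n) (z : 'cV[R]_n) : R :=
  \sum_(sigma < n)
    invmx g alpha sigma * 'D_(e sigma) ('D_(e mu) ('D_(e nu) F)) z.

Let c alpha mu nu (p : R * 'cV[R]_n) : R := structure_const alpha mu nu p.2.

Definition open_WDVV1 (p : R * 'cV[R]_n) : Prop := forall mu nu rho : 'I_n,
  \sum_(alpha < n) c alpha mu nu p * 'D_(ez alpha) ('D_(ez rho) Omega) p
    + 'D_ex ('D_(ez rho) Omega) p * 'D_(ez mu) ('D_(ez nu) Omega) p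
  = \sum_(alpha < n) c alpha nu rho p * 'D_(ez alpha) ('D_(ez mu) Omega) p
    + 'D_ex ('D_(ez mu) Omega) p * 'D_(ez nu) ('D_(ez rho) Omega) p.

Definition open_WDVV2 (p : R * 'cV[R]_n) : Prop := forall mu nu : 'I_n,
  \sum_(alpha < n) c alpha mu nu p * 'D_ex ('D_(ez alpha) Omega) p
    + 'D_ex ('D_ex Omega) p * 'D_(ez mu) ('D_(ez nu) Omega) p
  = 'D_ex ('D_(ez mu) Omega) p * 'D_ex ('D_(ez nu) Omega) p.

Definition open_WDVV (D : set (R * 'cV[R]_n)) : Prop :=
  forall p, D p -> open_WDVV1 p /\ open_WDVV2 p.

End OpenWDVV.

Definition eq_class (D : {fset 'rV[R]_n}) v : {fset 'rV[R]_n} :=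
  [fset w in D | v ~~~ w]%fset.

Definition eq_classes (D : {fset 'rV[R]_n}) : {fset {fset 'rV[R]_n}} :=
  [fset eq_class D v | v in D]%fset.

Section OpenVeeSystem.
Variables (A Ap B : {fset 'rV[R]_n}) (hA : 'rV[R]_n -> R) (h : R).
Variables (k : 'rV[R]_n -> R) (b0 : 'rV[R]_n).

Definition nonorthogonal : {fset 'rV[R]_n} :=
  [fset a in Ap | dual_metric A hA h a b0 != 0]%fset.

Definition differences : {fset 'rV[R]_n} :=
  [fset b0 - b | b in (B `\ b0)%fset]%fset.

Definition Bbullet : {fset 'rV[R]_n} :=
  [fset v in differences | has (fun a => v ~~~ a) nonorthogonal]%fset.

Definition Bcirc : {fset 'rV[R]_n} :=
  [fset v in differences | ~~ has (fun a => v ~~~ a) nonorthogonal]%fset.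

(* All differences defining the same hyperplane as a.  When there are none
   this is the empty set, which is not an equivalence class; that rho maps into
   eq_classes Bbullet is thus part of the bijectivity condition below. *)
Definition rho a : {fset 'rV[R]_n} := [fset v in Bbullet | v ~~~ a]%fset.

Definition rho_bijective : Prop :=
  set_bij [set` nonorthogonal] [set` eq_classes Bbullet] rho.

(* For a difference v = b0 - b the constant k_v is k b, and b = b0 - v. *)
Definition bullet_residues : Prop := forall a, a \in nonorthogonal ->
  \sum_(v <- rho a) k (b0 - v) *: v
  = (hA a * dual_metric A hA h a b0) *: a.

Definition circ_residues : Prop := forall C, C \in eq_classes Bcirc ->
  \sum_(b <- B | b0 - b \in C) k b *: (b - b0) = 0.

End OpenVeeSystem.

Definition open_vee_system (A Ap B : {fset 'rV[R]_n})
    (hA : 'rV[R]_n -> R) (h : R) (k : 'rV[R]_n -> R) : Prop :=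
  forall b0, b0 \in B ->
    [/\ rho_bijective A Ap B hA h b0,
        bullet_residues A Ap B hA h k b0
      & circ_residues A Ap B hA h k b0].

Lemma metric_gram A hA h X Y : metric A hA h X Y = (X^T *m gram A hA h *m Y) 0 0.
Proof.
have gramE : gram A hA h = (2 * h)^-1 *: \sum_(a <- A) hA a *: (a^T *m a).
  apply/matrixP => i j; rewrite !mxE /metric summxE; congr (_ * _).
  apply: eq_bigr => a _; rewrite /pairing !mxE big_ord1 !mxE -mulrA.
  congr (_ * (_ * _)).
    rewrite (bigD1 i) //= mxE !eqxx mulr1 big1 ?addr0 // => l /negPf li.
    by rewrite mxE li mulr0.
  rewrite (bigD1 j) //= mxE !eqxx mulr1 big1 ?addr0 // => l /negPf lj.
  by rewrite mxE lj mulr0.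
rewrite gramE -scalemxAr -scalemxAl mxE /metric; congr (_ * _).
rewrite mulmx_sumr mulmx_suml summxE; apply: eq_bigr => a _.
rewrite -scalemxAr -scalemxAl mxE -mulrA; congr (_ * _).
rewrite /pairing mulmxA -(mulmxA (X^T *m a^T)) -trmx_mul.
by rewrite [in RHS]mxE big_ord1 [in RHS]mxE.
Qed.

Lemma gram_unit A hA h : nondegenerate_metric A hA h -> gram A hA h \in unitmx.
Proof.
move=> nd; rewrite -row_free_unit -kermx_eq0; apply/eqP/row_matrixP => i.
rewrite row0; apply: trmx_inj; rewrite trmx0; apply: nd => Y.
rewrite metric_gram trmxK.
by rewrite -row_mul mulmx_ker row0 mul0mx mxE.
Qed.

Lemma metric_dual_vector A hA h a Y : nondegenerate_metric A hA h ->
  metric A hA h (dual_vector A hA h a) Y = pairing a Y.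
Proof.
move=> nd; have gU := gram_unit nd; rewrite metric_gram /dual_vector trmx_mul trmxK.
have gT : (gram A hA h)^T = gram A hA h.
  apply/matrixP => i j; rewrite !mxE /metric; congr (_ * _).
  by apply: eq_bigr => b _; rewrite mulrAC.
by rewrite trmx_inv gT mulmxKV.
Qed.

End VeeSystems.

(* Main.v *)
Require Import Defs.
From HB Require Import structures.
From mathcomp Require Import all_boot all_order all_algebra finmap.
From mathcomp Require Import all_classical all_reals all_analysis.
From mathcomp Require Import ring.

Set Implicit Arguments.
Unset Strict Implicit.
Unset Printing Implicit Defensive.

Import Order.TTheory GRing.Theory Num.Theory.
Import numFieldNormedType.Exports.

Local Open Scope classical_set_scope.
Local Open Scope ring_scope.

(** With u_b = x - b(z), the second open WDVV equation is a sum of terms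
    k_b k_b' (b - b') (x) (b - b') / (u_b u_b'), and
    1/(u_b u_b') = (1/u_b - 1/u_b') / (b - b')(z) turns it into a sum of simple
    poles in x.  Since the poles are distinct for generic z, it holds iff for every b0
      sum_(b != b0) k_b (b0 - b) (x) (b0 - b) / (b0 - b)(z)
        = sum_a h_a <a, b0> a (x) a / a(z),
    and comparing residues along each hyperplane gives conditions (ii) and (iii);
    (i) follows from (ii) because the right-hand side there never vanishes.
    The same partial fractions show that these identities also imply the first
    open WDVV equation.  Points z at which some (b - b')(z) vanishes are reached by
    continuity. *)

(** * Simple fractions and directional derivatives *)

Lemma near_all_in {T : Type} {F : set_system T} {FF : Filter F} (I : eqType)
    (s : seq I) (P : I -> T -> Prop) :
  (forall i, i \in s -> \forall t \near F, P i t) ->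
  \forall t \near F, forall i, i \in s -> P i t.
Proof.
elim: s => [|j s IH] sP; first by apply: nearW => t i.
have Pj : \forall t \near F, P j t by apply: sP; rewrite mem_head.
have Ps : \forall t \near F, forall i, i \in s -> P i t.
  by apply: IH => i si; apply: sP; rewrite in_cons si orbT.
apply: filterS2 Pj Ps => t Pjt Pst i.
by rewrite in_cons => /predU1P[->|/Pst].
Qed.

Section AffineLines.
Context {R : realType}.
Implicit Types (p q t : R).

Lemma cvg_affine p q : p + t * q @[t --> (0 : R)] --> p.
Proof.
suff : p + t * q @[t --> (0 : R)] --> p + 0 * q by rewrite mul0r addr0.
apply: cvgD; first exact: cvg_cst.
by apply: cvgM; [exact: cvg_id|exact: cvg_cst].
Qed.

Lemma near_affine_neq0 p q : p != 0 -> \forall t \near (0 : R), p + t * q != 0.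
Proof. move=> p0; pose f : R -> R^o := fun t => p + t * q.
exact: (@cvgr_neq0 R R^o R (nbhs (0 : R)) _ f p (@cvg_affine p q) p0). Qed.

Lemma dnbhs_affine_neq0 p q : (p == 0 -> q != 0) ->
  \forall t \near (0 : R)^', p + t * q != 0.
Proof.
move=> pq; have [p0|p0] := eqVneq p 0; last first.
  exact: (nbhs_dnbhs (near_affine_neq0 q p0)).
apply: filterS (nbhs_dnbhs_neq (0 : R)) => t t0.
by rewrite p0 add0r mulf_neq0 // pq ?p0.
Qed.

(** Used both to extract residues and to reach non-generic points: convergence along the full
    neighbourhood filter restricts to the punctured one, where [f] is zero, and limits are
    unique. *)
Lemma cvg_eq0 (f : R -> R) l : f t @[t --> (0 : R)] --> l ->
  (\forall t \near (0 : R)^', f t = 0) -> l = 0.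
Proof.
move=> fl f0; have fl' : f t @[t --> (0 : R)^'] --> l.
  by move=> P /fl; exact: nbhs_dnbhs.
have f0' : f t @[t --> (0 : R)^'] --> (0 : R).
  move=> P P0; apply: filterS f0 => t ft; rewrite /= ft.
  exact: nbhs_singleton P0.
exact: (cvg_unique (@Rhausdorff R) fl' f0').
Qed.

Lemma cvg_bigsum (I : Type) (s : seq I) (P : pred I) (f : I -> R -> R) (l : I -> R) :
  (forall i, P i -> f i t @[t --> (0 : R)] --> l i) ->
  \sum_(i <- s | P i) f i t @[t --> (0 : R)] --> \sum_(i <- s | P i) l i.
Proof. by apply: cvg_big; exact: add_continuous. Qed.

Lemma cvg_bigsum_in (I : eqType) (s : seq I) (f : I -> R -> R) (l : I -> R) :
  (forall i, i \in s -> f i t @[t --> (0 : R)] --> l i) ->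
  \sum_(i <- s) f i t @[t --> (0 : R)] --> \sum_(i <- s) l i.
Proof.
move=> fl; rewrite big_seq; under eq_fun do rewrite big_seq.
exact: cvg_bigsum.
Qed.

Lemma cvg_div_affine (c p q : R) : p != 0 ->
  c / (p + t * q) @[t --> (0 : R)] --> c / p.
Proof.
by move=> p0; apply: cvgM; [exact: cvg_cst|apply: cvgV => //; exact: cvg_affine].
Qed.

(** Multiply the sum by t and let t tend to 0: the terms with [p i != 0] die out, while those with
    [p i = 0] are constantly [c i / q i]. *)
Lemma residue_eq0 (I : eqType) (s : seq I) (c p q : I -> R) :
  (forall i, i \in s -> p i == 0 -> q i != 0) ->
  (\forall t \near (0 : R)^', \sum_(i <- s) c i / (p i + t * q i) = 0) ->
  \sum_(i <- s | p i == 0) c i / q i = 0.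
Proof.
move=> pq s0.
(* Off t = 0 this is t times the given sum. Cancelling t in the polar terms beforehand makes it
   continuous at 0, where the division would otherwise return the default value 0. *)
pose f t := \sum_(i <- s) if p i == 0 then c i / q i else t * (c i / (p i + t * q i)).
pose l := \sum_(i <- s) if p i == 0 then c i / q i else 0.
have fl : f t @[t --> (0 : R)] --> l.
  apply: cvg_bigsum_in => i si; have [_|pi] := eqVneq (p i) 0; first exact: cvg_cst.
  rewrite -[X in _ --> X](mul0r (c i / p i)).
  by apply: cvgM; [exact: cvg_id|exact: cvg_div_affine].
rewrite big_mkcond; apply: (cvg_eq0 fl).
apply: filterS2 s0 (nbhs_dnbhs_neq (0 : R)) => t s0 t0.
rewrite -[RHS](mulr0 t) -[X in _ = t * X]s0 mulr_sumr /f.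
apply: eq_big_seq => i si; case: ifP => // /[dup] pi0 /eqP ->.
have := pq i si pi0 => qi; rewrite add0r invfM mulrCA [t * _]mulrA.
by rewrite divff // mul1r.
Qed.

End AffineLines.

(** * Derivatives of sums of functions of linear forms *)

Section LineDerivatives.
Context {R : realType}.
Implicit Types (u : R).

Lemma is_derive_ln_norm u : u != 0 -> is_derive u 1 (fun u => ln `|u| : R) u^-1.
Proof.
move=> u0; have [up|un|u0'] := ltgtP u 0; last by rewrite u0' eqxx in u0.
  have H : is_derive u 1 ((@ln R) \o -%R) ((- u)^-1 * -1).
    by apply: is_derive1_comp; apply: is_derive1_ln; rewrite oppr_gt0.
  rewrite invrN mulrN1 opprK in H; apply: near_eq_is_derive H.
  by near=> t; rewrite /= ltr0_norm //; near: t; exact: lt_nbhsl.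
apply: near_eq_is_derive (is_derive1_ln un).
by near=> t; rewrite gtr0_norm //; near: t; exact: lt_nbhsr.
Unshelve. all: by end_near. Qed.

Lemma is_derive_mul_ln u : u != 0 ->
  is_derive u 1 (fun u => u * ln `|u| : R) (ln `|u| + 1).
Proof.
move=> u0; have H := is_deriveM (is_derive_id u (1 : R)) (is_derive_ln_norm u0).
by apply: is_derive_eq H _; rewrite /= /GRing.scale /=; field.
Qed.

Lemma is_derive_sqr_mul_ln u : u != 0 ->
  is_derive u 1 (fun u => u ^+ 2 * ln `|u| : R) (2 * (u * ln `|u|) + u).
Proof.
move=> u0.
have H := is_deriveM (is_deriveX 2 (is_derive_id u (1 : R))) (is_derive_ln_norm u0).
by apply: is_derive_eq H _; rewrite /= /GRing.scale /=; rewrite [X in X / u](_ : _ = u ^+ 2) //; field.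
Qed.

Lemma derive_line (V : normedModType R) (f : V -> R) (a v : V) :
  'D_v f a = 'D_1 (fun t : R => f (a + t *: v)) 0.
Proof.
rewrite /derive; set G := (X in _ = lim (X @ _)); set F := (X in lim (X @ _) = _).
suff -> : F = G by [].
apply/funext => t; rewrite /F /G /=.
by rewrite addr0 scale0r addr0 -[t *: 1]/(t * 1) mulr1 [a + _]addrC.
Qed.

(** The derivative has the same shape with [phi] replaced by [psi], so the rule can be iterated. The
    shape of [f] is required only where no [L i] vanishes: this condition persists near [a] along
    any line, and it is all that a previous application of the rule provides. *)
Lemma derive_sum_linear_forms (V : normedModType R) (I : eqType) (s : seq I)
    (c : I -> R) (L dL : I -> V -> R) (phi psi : R -> R) (f : V -> R) (a v : V) :
  (forall i x t y, L i (x + t *: y) = L i x + t * dL i y) ->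
  (forall u, u != 0 -> is_derive u 1 phi (psi u)) ->
  (forall x, (forall i, i \in s -> L i x != 0) ->
     f x = \sum_(i <- s) c i * phi (L i x)) ->
  (forall i, i \in s -> L i a != 0) ->
  'D_v f a = \sum_(i <- s) c i * dL i v * psi (L i a).
Proof.
move=> Llin phipsi fE La; rewrite derive_line.
pose g (t : R) := \sum_(i <- s) c i * phi (L i a + t * dL i v).
have -> : 'D_1 (fun t : R => f (a + t *: v)) 0 = 'D_1 g (0 : R).
  apply: near_eq_derive.
  have : \forall t \near (0 : R), forall i, i \in s -> L i a + t * dL i v != 0.
    have H i : i \in s -> \forall t \near (0 : R), L i a + t * dL i v != 0.
      by move=> si; apply: near_affine_neq0; exact: La.
    exact: near_all_in H.
  apply: filterS => t Lt; rewrite fE => [|i si]; last by rewrite Llin Lt.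
  by apply: eq_bigr => i _; rewrite Llin.
suff : is_derive (0 : R) 1 g (\sum_(i <- s) c i * dL i v * psi (L i a)).
  by case.
rewrite {}/g; elim: s {f fE} La => [|i s IH] La.
  by rewrite big_nil; under eq_fun do rewrite big_nil; exact: is_derive_cst.
rewrite big_cons; under eq_fun do rewrite big_cons.
have {}IH : is_derive (0 : R) 1 (fun t => \sum_(j <- s) c j * phi (L j a + t * dL j v))
    (\sum_(j <- s) c j * dL j v * psi (L j a)).
  by apply: IH => j sj; apply: La; rewrite in_cons sj orbT.
have Lia : L i a + 0 * dL i v != 0 by rewrite mul0r addr0 La ?mem_head.
have H1 : is_derive (0 : R) 1 (fun t => L i a + t * dL i v) (dL i v).
  have H2 := is_deriveM (is_derive_id (0 : R) (1 : R)) (is_derive_cst (dL i v) (0 : R) 1).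
  apply: is_derive_eq (is_deriveD (is_derive_cst (L i a) (0 : R) 1) H2) _.
  by rewrite /= /GRing.scale /=; ring.
have H2 := is_deriveD (is_deriveZ (c i) (is_derive1_comp (g := fun t => _ + t * _) (phipsi _ Lia) H1)) IH.
set G := (X in is_derive _ _ X _); set G2 := (X in is_derive _ _ X _) in H2.
have <- : G2 = G by apply/funext.
by apply: is_derive_eq H2 _; rewrite /= /GRing.scale /= mul0r addr0; ring.
Qed.

End LineDerivatives.

Arguments derive_sum_linear_forms {R V I s c L dL phi psi f a v}.

(** * Residues along hyperplanes *)

Section Covectors.
Context {R : realType} {n : nat}.
Implicit Types (a b v w : 'rV[R]_n) (x y z : 'cV[R]_n).

Lemma pairingDr a x y : pairing a (x + y) = pairing a x + pairing a y.
Proof. by rewrite /pairing mulmxDr mxE. Qed.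

Lemma pairingZr a t x : pairing a (t *: x) = t * pairing a x.
Proof. by rewrite /pairing -scalemxAr mxE. Qed.

Lemma pairing0r a : pairing a 0 = 0.
Proof. by rewrite /pairing mulmx0 mxE. Qed.

Lemma pairingBl a b x : pairing (a - b) x = pairing a x - pairing b x.
Proof. by rewrite /pairing mulmxBl !mxE. Qed.

Lemma pairingZl t a x : pairing (t *: a) x = t * pairing a x.
Proof. by rewrite /pairing -scalemxAl mxE. Qed.

Lemma pairing_delta a i : pairing a (delta_mx i 0) = a 0 i.
Proof. by rewrite /pairing -colE mxE. Qed.

Lemma pairing_inj a b : (forall x, pairing a x = pairing b x) -> a = b.
Proof.
by move=> ab; apply/rowP => i; have := ab (delta_mx i 0); rewrite !pairing_delta.
Qed.

Lemma exists_pairing1 a : a != 0 -> exists y, pairing a y = 1.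
Proof.
move=> a0; have [i ai] : exists i, a 0 i != 0.
  apply/existsP; apply: contra_neqT a0 => /existsPn a0; apply/rowP => i.
  by rewrite mxE; apply/eqP; rewrite -[_ == _]negbK.
by exists ((a 0 i)^-1 *: delta_mx i 0); rewrite pairingZr pairing_delta mulVf.
Qed.

Lemma same_hyperplaneP a b :
  reflect (hyperplane a = hyperplane b) (same_hyperplane a b).
Proof. exact: asboolP. Qed.

Lemma same_hyperplane_refl a : same_hyperplane a a.
Proof. exact/same_hyperplaneP. Qed.

Lemma same_hyperplane_sym a b : same_hyperplane a b = same_hyperplane b a.
Proof. by apply/same_hyperplaneP/same_hyperplaneP. Qed.

Lemma same_hyperplane_trans b a c :
  same_hyperplane a b -> same_hyperplane b c -> same_hyperplane a c.
Proof.
by move=> /same_hyperplaneP ab /same_hyperplaneP bc; apply/same_hyperplaneP; rewrite ab.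
Qed.

Lemma same_hyperplane_left a b c :
  same_hyperplane a b -> same_hyperplane a c = same_hyperplane b c.
Proof.
move=> ab; apply/idP/idP; last exact: same_hyperplane_trans.
by apply: same_hyperplane_trans; rewrite same_hyperplane_sym.
Qed.

Lemma same_hyperplane_pairing_eq0 a b x : same_hyperplane a b ->
  (pairing a x == 0) = (pairing b x == 0).
Proof.
move=> /same_hyperplaneP ab.
have abx : hyperplane a x = hyperplane b x by rewrite ab.
by apply/eqP/eqP; rewrite -[_ = 0]/(hyperplane _ x) ?abx // -abx.
Qed.

(** Every z differs from [pairing a z *: y] by a vector on the hyperplane of [a], and [b] vanishes
    there. *)
Lemma covector_scale a b y : pairing a y = 1 ->
  (forall z, pairing a z = 0 -> pairing b z = 0) -> b = pairing b y *: a.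
Proof.
move=> ay ab; apply: pairing_inj => z; rewrite pairingZl.
have := ab (z + (- pairing a z) *: y); rewrite !pairingDr !pairingZr ay => /(_ _)/eqP.
by rewrite mulr1 subrr => /(_ erefl)/eqP; rewrite mulNr => /subr0_eq; rewrite mulrC.
Qed.

Lemma same_hyperplane_scale a b y : pairing a y = 1 -> same_hyperplane a b ->
  b = pairing b y *: a.
Proof.
move=> ay ab; apply: covector_scale => // z /eqP az; apply/eqP.
by rewrite -(same_hyperplane_pairing_eq0 z ab).
Qed.

Lemma scale_same_hyperplane t a : t != 0 -> same_hyperplane (t *: a) a.
Proof.
move=> t0; apply/same_hyperplaneP/seteqP; split=> z; rewrite /hyperplane /= pairingZl.
  by move=> /eqP; rewrite mulf_eq0 (negPf t0) => /eqP.
by move=> ->; rewrite mulr0.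
Qed.

(** Otherwise [b] would vanish on the hyperplane of [a] and so be a multiple of [a], non-zero
    because [b] is, hence with the same hyperplane. *)
Lemma exists_separating a b : a != 0 -> b != 0 -> ~~ same_hyperplane a b ->
  exists z, pairing a z = 0 /\ pairing b z != 0.
Proof.
move=> a0 b0; apply: contraNP => nex.
have [y ay] := exists_pairing1 a0.
have bE : b = pairing b y *: a.
  apply: covector_scale ay _ => z az; apply/eqP/negPn/negP => bz.
  by apply: nex; exists z.
rewrite same_hyperplane_sym bE scale_same_hyperplane //.
by apply: contraNneq b0 => by0; rewrite bE by0 scale0r.
Qed.

(** A real subspace [S] is not a finite union of proper subspaces. In the induction, a point good
    for the tail is moved slightly in a direction good for the head; each covector then vanishes for
    no small non-zero parameter. *)
Lemma exists_avoiding (S : set 'cV[R]_n) (s : seq 'rV[R]_n) :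
  S 0 -> (forall x y t, S x -> S y -> S (x + t *: y)) ->
  (forall w, w \in s -> exists z, S z /\ pairing w z != 0) ->
  exists z, S z /\ forall w, w \in s -> pairing w z != 0.
Proof.
move=> S0 SD; elim: s => [|w s IH] sP; first by exists 0.
have [|z1 [Sz1 z1P]] := IH; first by move=> v sv; apply: sP; rewrite in_cons sv orbT.
have [z2 [Sz2 wz2]] := sP w (mem_head _ _).
have H v : v \in w :: s ->
    \forall t \near (0 : R)^', pairing v z1 + t * pairing v z2 != 0.
  move=> vs; apply: dnbhs_affine_neq0 => /eqP vz1.
  by case/predU1P: vs => [-> //|/z1P]; rewrite vz1 eqxx.
have [t tP] := filter_ex (near_all_in H).
exists (z1 + t *: z2); split; first exact: SD.
by move=> v vs; rewrite pairingDr pairingZr; exact: tP.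
Qed.

(* The identity gets multiplied by a and evaluated on the hyperplane of a: only
   the covectors proportional to a survive. *)
Lemma residue_of_identity (s : seq (R * 'rV[R]_n)) (s' : seq 'rV[R]_n) :
  {subset map snd s <= s'} -> 0 \notin s' ->
  (forall z, (forall w, w \in s' -> pairing w z != 0) -> forall mu nu,
     \sum_(i <- s) i.1 * i.2 0 mu * i.2 0 nu / pairing i.2 z = 0) ->
  forall a, a != 0 -> \sum_(i <- s | same_hyperplane i.2 a) i.1 *: i.2 = 0.
Proof.
move=> ss' s'0 sE a a0; have [y ay] := exists_pairing1 a0.
have s'_neq0 w : w \in s' -> w != 0 by apply: contraTneq => ->.
(* A point of the hyperplane of [a] on none of the other walls. Leaving it in the direction [y]
   makes exactly the covectors proportional to [a] contribute a pole at t = 0. *)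
have [|||z0 [az0 z0P]] := @exists_avoiding (hyperplane a)
    [seq w <- s' | ~~ same_hyperplane a w].
- exact: pairing0r.
- by move=> x z t xa za; rewrite /hyperplane /= pairingDr pairingZr xa za mulr0 addr0.
- move=> w; rewrite mem_filter => /andP[aw s'w].
  exact: exists_separating (s'_neq0 w s'w) aw.
have pz0 w : w \in s' -> (pairing w z0 == 0) = same_hyperplane w a.
  move=> s'w; apply/idP/idP => [|wa].
    rewrite same_hyperplane_sym; apply: contraTT => aw.
    by apply: z0P; rewrite mem_filter aw.
  by rewrite (same_hyperplane_pairing_eq0 _ wa); apply/eqP.
have py w : w \in s' -> pairing w z0 == 0 -> pairing w y != 0.
  move=> s'w; rewrite pz0 // => /same_hyperplane_pairing_eq0 ->.
  by rewrite ay oner_neq0.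
have si2 i : i \in s -> i.2 \in s' by move=> si; apply/ss'/map_f.
have H mu nu : \sum_(i <- s | pairing i.2 z0 == 0)
    (i.1 * i.2 0 mu * i.2 0 nu) / pairing i.2 y = 0.
  apply: (residue_eq0 (p := fun i => pairing i.2 z0)); first by move=> i /si2/py.
  have K w : w \in s' -> \forall t \near (0 : R)^', pairing w z0 + t * pairing w y != 0.
    by move=> s'w; apply: dnbhs_affine_neq0; exact: py.
  apply: filterS (near_all_in K) => t tP.
  rewrite -[RHS](sE (z0 + t *: y) _ mu nu); last first.
    by move=> w s'w; rewrite pairingDr pairingZr tP.
  by apply: eq_bigr => i _; rewrite pairingDr pairingZr.
(* A surviving [i.2] equals [pairing i.2 y *: a], so [i.2 0 nu / pairing i.2 y] is the constant
   [a 0 nu]. With this entry non-zero it can be cancelled, leaving the vector-valued residue. *)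
have [nu anu] : exists nu, a 0 nu != 0.
  apply/existsP; apply: contra_neqT a0 => /existsPn a0; apply/rowP => i.
  by rewrite mxE; apply/eqP; rewrite -[_ == _]negbK.
apply/rowP => mu; rewrite summxE mxE; apply: (mulIf anu); rewrite mul0r -[RHS](H mu nu).
rewrite mulr_suml big_seq_cond [RHS]big_seq_cond; apply: eq_big => [i|i /andP[si ia]].
  by case si: (i \in s) => //=; rewrite pz0 ?si2.
have iy : pairing i.2 y != 0 by apply: py; rewrite ?pz0 ?si2.
have inu : i.2 0 nu = pairing i.2 y * a 0 nu.
  by rewrite [in LHS](same_hyperplane_scale (b := i.2) ay) ?mxE // same_hyperplane_sym.
by rewrite !mxE inu; field.
Qed.

(* Two covectors have the same w / w(z) iff they define the same hyperplane, so the
   terms can be grouped by that value. *)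
Lemma identity_of_residues (s : seq (R * 'rV[R]_n)) z :
  (forall i, i \in s -> pairing i.2 z != 0) ->
  (forall a, a != 0 -> \sum_(i <- s | same_hyperplane i.2 a) i.1 *: i.2 = 0) ->
  forall mu nu, \sum_(i <- s) i.1 * i.2 0 mu * i.2 0 nu / pairing i.2 z = 0.
Proof.
move=> sz sP mu nu; pose N w := (pairing w z)^-1 *: w.
pose S := undup (map (fun i => N i.2) s).
have NE v w : pairing v z != 0 -> pairing w z != 0 ->
    (N v == N w) = same_hyperplane v w.
  move=> vz wz; apply/eqP/idP => [vw|vw].
    have -> : v = (pairing v z / pairing w z) *: w.
      by rewrite -scalerA -/(N w) -vw scalerA divff ?scale1r.
    by rewrite scale_same_hyperplane // mulf_neq0 ?invr_eq0.
  have Nv1 : pairing (N v) z = 1 by rewrite pairingZl mulVf.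
  have vNw : same_hyperplane (N v) w.
    by apply: same_hyperplane_trans vw; rewrite scale_same_hyperplane ?invr_eq0.
  by rewrite {2}/N {2}(same_hyperplane_scale Nv1 vNw) scalerA mulVf ?scale1r.
(* The factor [i.2 0 nu / pairing i.2 z] is an entry of [N i.2], so it is constant on each group and
   comes out of the residue sum. *)
have -> : \sum_(i <- s) i.1 * i.2 0 mu * i.2 0 nu / pairing i.2 z =
    \sum_(m <- S) \sum_(i <- s | N i.2 == m) i.1 * i.2 0 mu * m 0 nu.
  rewrite (exchange_big_dep predT) //=; apply: eq_big_seq => i si.
  rewrite -big_filter (@eq_filter _ _ (pred1 (N i.2))); last first.
    by move=> m; rewrite /= eq_sym.
  have SNi : N i.2 \in S by rewrite mem_undup; apply/mapP; exists i.
  by rewrite filter_pred1_uniq ?undup_uniq // big_seq1 mxE; ring.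
apply: big1_seq => m /andP[_]; rewrite mem_undup => /mapP[j sj ->{m}].
have j0 : j.2 != 0.
  by apply: contraNneq (sz j sj) => ->; rewrite /pairing mul0mx mxE.
have := congr1 (fun w : 'rV_n => w 0 mu * N j.2 0 nu) (sP j.2 j0).
rewrite summxE !mxE mul0r mulr_suml big_seq_cond => {2}<-.
rewrite [LHS]big_seq_cond; apply: eq_big => [i|i _]; last by rewrite !mxE; ring.
by case si: (i \in s) => //=; rewrite NE // sz.
Qed.

End Covectors.

(** * The WDVV equations as rational identities *)

Lemma dual_metricC (R : realType) (n : nat) (A : {fset 'rV[R]_n}) hA h a b :
  dual_metric A hA h a b = dual_metric A hA h b a.
Proof.
have gT : (gram A hA h)^T = gram A hA h.
  apply/matrixP => i j; rewrite !mxE /metric; congr (_ * _).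
  by apply: eq_bigr => c _; rewrite mulrAC.
rewrite /dual_metric /dual_vector /pairing -[LHS]trace_mx11 -[RHS]trace_mx11.
by rewrite -mxtrace_tr !trmx_mul trmxK trmx_inv gT mulmxA.
Qed.

Section Derivatives.
Context {R : realType} {n : nat}.
Variables (A Ap B : {fset 'rV[R]_n}) (hA : 'rV[R]_n -> R) (h : R) (k : 'rV[R]_n -> R).
Implicit Types (a b : 'rV[R]_n) (z : 'cV[R]_n) (p q : R * 'cV[R]_n).

Let F := closed_prepotential Ap hA.
Let Omega := open_prepotential B k.
Let e (i : 'I_n) : 'cV[R]_n := delta_mx i 0.

Definition ext_pairing b p : R := p.1 - pairing b p.2.

Lemma closed_prepotential_D3 z (la mu nu : 'I_n) :
  (forall a, a \in Ap -> pairing a z != 0) ->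
  'D_(e la) ('D_(e mu) ('D_(e nu) F)) z =
  \sum_(a <- Ap) hA a * a 0 la * a 0 mu * a 0 nu / pairing a z.
Proof.
have L a (x : 'cV[R]_n) t y : pairing a (x + t *: y) = pairing a x + t * pairing a y.
  by rewrite pairingDr pairingZr.
have dphi2 (u : R) : u != 0 ->
    is_derive u 1 (fun u : R => 2 * (u * ln `|u|) + u) (2 * (ln `|u| + 1) + 1).
  by move=> u0; apply: is_derive_eq (is_deriveD (is_deriveZ 2 (is_derive_mul_ln u0))
    (is_derive_id u (1 : R))) _.
have dphi3 (u : R) : u != 0 ->
    is_derive u 1 (fun u : R => 2 * (ln `|u| + 1) + 1) (2 * u^-1).
  move=> u0; apply: is_derive_eq (is_deriveD (is_deriveZ 2 (is_deriveD
    (is_derive_ln_norm u0) (is_derive_cst (1 : R) u 1))) (is_derive_cst (1 : R) u 1)) _.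
  by rewrite /GRing.scale /= !addr0.
(* Three passes of the rule: [u ^+ 2 * ln |u|], then [2 * (u * ln |u|) + u], then
   [2 * (ln |u| + 1) + 1], then [2 / u]. The last factor 2 cancels the 1/2 in [F]. *)
have D1 x v := derive_sum_linear_forms (f := F) (s := Ap) (a := x) (v := v)
  (c := fun a => 2^-1 * hA a) L (@is_derive_sqr_mul_ln R).
have D2 x v w := derive_sum_linear_forms (f := 'D_w F) (s := Ap) (a := x) (v := v)
  (c := fun a => 2^-1 * hA a * pairing a w) L dphi2.
have D3 x v w w' := derive_sum_linear_forms (f := 'D_w ('D_w' F)) (s := Ap) (a := x)
  (v := v) (c := fun a => 2^-1 * hA a * pairing a w' * pairing a w) L dphi3.
move=> zA; rewrite D3 // => [|x xA].
  by apply: eq_big_seq => a /zA az; rewrite !pairing_delta; field.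
apply: D2 => // y yA; apply: D1 => // w wA.
rewrite /F /closed_prepotential mulr_sumr.
by apply: eq_bigr => a _; rewrite !mulrA.
Qed.

Lemma open_prepotential_D2 p q q' :
  (forall b, b \in B -> ext_pairing b p != 0) ->
  'D_q ('D_q' Omega) p =
  \sum_(b <- B) k b * ext_pairing b q' * ext_pairing b q / ext_pairing b p.
Proof.
have L b (x : R * 'cV[R]_n) t y : ext_pairing b (x + t *: y) = ext_pairing b x + t * ext_pairing b y.
  rewrite /ext_pairing /= pairingDr pairingZr mulrBr opprD addrACA.
  by rewrite -[t *: y.1]/(t * y.1).
have dphi (u : R) : u != 0 -> is_derive u 1 (fun u : R => ln `|u| + 1) u^-1.
  move=> u0; apply: is_derive_eq
    (is_deriveD (is_derive_ln_norm u0) (is_derive_cst (1 : R) u 1)) _.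
  by rewrite addr0.
have D1 x v := derive_sum_linear_forms (f := Omega) (s := B) (a := x) (v := v) (c := k)
  L (@is_derive_mul_ln R).
have D2 x v := derive_sum_linear_forms (f := 'D_q' Omega) (s := B) (a := x) (v := v)
  (c := fun b => k b * ext_pairing b q') L dphi.
move=> pB; apply: D2 => // x xB; apply: D1 => // y yB.
by apply: eq_bigr => b _; rewrite mulrA.
Qed.

Lemma structure_constE z (al mu nu : 'I_n) :
  (forall a, a \in Ap -> pairing a z != 0) ->
  structure_const (gram A hA h) F al mu nu z =
  \sum_(a <- Ap) hA a * dual_vector A hA h a al 0 * a 0 mu * a 0 nu / pairing a z.
Proof.
move=> zA; rewrite /structure_const.
under eq_bigr do rewrite closed_prepotential_D3 // mulr_sumr.
rewrite exchange_big; apply: eq_bigr => a _ /=.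
rewrite mxE mulr_sumr !mulr_suml; apply: eq_bigr => i _; rewrite mxE; ring.
Qed.

(** The structure constants with the upper index contracted with [b]; equivalently, the derivative
    of the right-hand side of the logarithmic identity whose residues are compared, with [b] as base
    covector. *)
Definition contracted_const b z (mu nu : 'I_n) : R :=
  \sum_(a <- Ap) hA a * dual_metric A hA h a b * a 0 mu * a 0 nu / pairing a z.

Lemma contract_structure_const (c : 'rV[R]_n -> R) z (mu nu : 'I_n) :
  (forall a, a \in Ap -> pairing a z != 0) ->
  \sum_(al < n) structure_const (gram A hA h) F al mu nu z *
     (\sum_(b <- B) c b * b 0 al) =
  \sum_(b <- B) c b * contracted_const b z mu nu.
Proof.
move=> zA; under eq_bigr do rewrite mulr_sumr.
rewrite exchange_big; apply: eq_bigr => b _ /=.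
under eq_bigr do rewrite structure_constE // mulr_suml.
rewrite exchange_big mulr_sumr; apply: eq_bigr => a _ /=.
rewrite dual_metricC /dual_metric {2}/pairing mxE mulr_sumr !mulr_suml mulr_sumr.
by apply: eq_bigr => i _; ring.
Qed.

(** The second open equation with all derivatives evaluated. Each z-derivative of x - b(z) gives a
    factor [- b 0 i], so the mixed derivatives carry a minus sign; the two on the right cancel. *)
Definition WDVV2_at p := forall mu nu : 'I_n,
  - \sum_(b <- B) k b / ext_pairing b p * contracted_const b p.2 mu nu
    + (\sum_(b <- B) k b / ext_pairing b p)
        * (\sum_(b <- B) k b * b 0 mu * b 0 nu / ext_pairing b p)
  = (\sum_(b <- B) k b * b 0 mu / ext_pairing b p)
      * (\sum_(b <- B) k b * b 0 nu / ext_pairing b p).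

Definition WDVV1_at p := forall mu nu rho : 'I_n,
  \sum_(b <- B) k b * b 0 rho / ext_pairing b p * contracted_const b p.2 mu nu
    - (\sum_(b <- B) k b * b 0 rho / ext_pairing b p)
        * (\sum_(b <- B) k b * b 0 mu * b 0 nu / ext_pairing b p)
  = \sum_(b <- B) k b * b 0 mu / ext_pairing b p * contracted_const b p.2 nu rho
    - (\sum_(b <- B) k b * b 0 mu / ext_pairing b p)
        * (\sum_(b <- B) k b * b 0 nu * b 0 rho / ext_pairing b p).

Lemma ext_pairing_z b i : ext_pairing b (0, e i) = - b 0 i.
Proof. by rewrite /ext_pairing /= pairing_delta sub0r. Qed.

Lemma ext_pairing_x b : ext_pairing b (1, 0) = 1.
Proof. by rewrite /ext_pairing /= pairing0r subr0. Qed.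

Section AtRegularPoint.
Variable p : R * 'cV[R]_n.
Hypothesis pB : forall b, b \in B -> ext_pairing b p != 0.

Lemma open_prepotential_Dxx :
  'D_(1, 0) ('D_(1, 0) Omega) p = \sum_(b <- B) k b / ext_pairing b p.
Proof.
rewrite open_prepotential_D2 //; apply: eq_bigr => b _.
by rewrite ext_pairing_x !mulr1.
Qed.

Lemma open_prepotential_Dxz i : 'D_(1, 0) ('D_(0, e i) Omega) p =
  - \sum_(b <- B) k b * b 0 i / ext_pairing b p.
Proof.
rewrite open_prepotential_D2 // -sumrN; apply: eq_bigr => b _.
by rewrite ext_pairing_x ext_pairing_z; ring.
Qed.

Lemma open_prepotential_Dzz i j : 'D_(0, e i) ('D_(0, e j) Omega) p =
  \sum_(b <- B) k b * b 0 i * b 0 j / ext_pairing b p.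
Proof.
rewrite open_prepotential_D2 //; apply: eq_bigr => b _.
by rewrite !ext_pairing_z; ring.
Qed.

Lemma open_WDVVE : (forall a, a \in Ap -> pairing a p.2 != 0) ->
  (open_WDVV1 (gram A hA h) F Omega p <-> WDVV1_at p) /\
  (open_WDVV2 (gram A hA h) F Omega p <-> WDVV2_at p).
Proof.
move=> pA.
have C1 mu nu rho : \sum_(al < n) structure_const (gram A hA h) F al mu nu p.2 *
    'D_(0, e al) ('D_(0, e rho) Omega) p =
    \sum_(b <- B) k b * b 0 rho / ext_pairing b p * contracted_const b p.2 mu nu.
  rewrite -contract_structure_const //; apply: eq_bigr => al _; congr (_ * _).
  by rewrite open_prepotential_Dzz; apply: eq_bigr => b _; ring.
have C2 mu nu : \sum_(al < n) structure_const (gram A hA h) F al mu nu p.2 *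
    'D_(1, 0) ('D_(0, e al) Omega) p =
    - \sum_(b <- B) k b / ext_pairing b p * contracted_const b p.2 mu nu.
  rewrite -contract_structure_const // -sumrN; apply: eq_bigr => al _; rewrite -mulrN.
  by rewrite open_prepotential_Dxz; congr (_ * - _); apply: eq_bigr => b _; ring.
have E1 mu nu rho :
    \sum_(al < n) structure_const (gram A hA h) F al mu nu p.2 *
      'D_(0, e al) ('D_(0, e rho) Omega) p +
      'D_(1, 0) ('D_(0, e rho) Omega) p * 'D_(0, e mu) ('D_(0, e nu) Omega) p =
    \sum_(b <- B) k b * b 0 rho / ext_pairing b p * contracted_const b p.2 mu nu
    - (\sum_(b <- B) k b * b 0 rho / ext_pairing b p)
        * (\sum_(b <- B) k b * b 0 mu * b 0 nu / ext_pairing b p).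
  rewrite -mulNr; congr (_ + _ * _).
  - exact: C1.
  - exact: open_prepotential_Dxz.
  - exact: open_prepotential_Dzz.
have E2 mu nu :
    \sum_(al < n) structure_const (gram A hA h) F al mu nu p.2 *
      'D_(1, 0) ('D_(0, e al) Omega) p +
      'D_(1, 0) ('D_(1, 0) Omega) p * 'D_(0, e mu) ('D_(0, e nu) Omega) p =
    - \sum_(b <- B) k b / ext_pairing b p * contracted_const b p.2 mu nu
    + (\sum_(b <- B) k b / ext_pairing b p)
        * (\sum_(b <- B) k b * b 0 mu * b 0 nu / ext_pairing b p).
  congr (_ + _ * _).
  - exact: C2.
  - exact: open_prepotential_Dxx.
  - exact: open_prepotential_Dzz.
have E3 mu nu :
    'D_(1, 0) ('D_(0, e mu) Omega) p * 'D_(1, 0) ('D_(0, e nu) Omega) p =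
    (\sum_(b <- B) k b * b 0 mu / ext_pairing b p)
      * (\sum_(b <- B) k b * b 0 nu / ext_pairing b p).
  by rewrite -[RHS]mulrNN; congr (_ * _); exact: open_prepotential_Dxz.
split; split=> H mu nu.
- move=> rho; exact: etrans (esym (E1 mu nu rho)) (etrans (H mu nu rho) (E1 nu rho mu)).
- move=> rho; exact: etrans (E1 mu nu rho) (etrans (H mu nu rho) (esym (E1 nu rho mu))).
- exact: etrans (esym (E2 mu nu)) (etrans (H mu nu) (E3 mu nu)).
- exact: etrans (E2 mu nu) (etrans (H mu nu) (esym (E3 mu nu))).
Qed.

End AtRegularPoint.

End Derivatives.

(** * The conditions of an open vee-system as residue conditions *)

Section ResidueConditions.
Context {R : realType} {n : nat}.
Variables (A Ap B : {fset 'rV[R]_n}) (hA : 'rV[R]_n -> R) (h : R) (k : 'rV[R]_n -> R).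
Variable b0 : 'rV[R]_n.
Implicit Types (a b v w : 'rV[R]_n).

Local Notation nonorth := (nonorthogonal A Ap hA h b0).
Local Notation Bb := (Bbullet A Ap B hA h b0).
Local Notation Bc := (Bcirc A Ap B hA h b0).
Local Notation rho := (rho A Ap B hA h b0).

(** Equality of the residues of both sides of the logarithmic identity along every hyperplane,
    before splitting the differences into bullet and circ ones. Covectors orthogonal to [b0] may
    stay in the sum, their coefficient being zero. *)
Definition residue_condition := forall a, a != 0 ->
  \sum_(b <- B | (b != b0) && same_hyperplane (b0 - b) a) k b *: (b0 - b) =
  \sum_(a' <- Ap | same_hyperplane a' a) (hA a' * dual_metric A hA h a' b0) *: a'.

Lemma in_nonorthogonal a : (a \in nonorth) = (a \in Ap) && (dual_metric A hA h a b0 != 0).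
Proof. by rewrite !inE. Qed.

Lemma in_differences b : (b0 - b \in differences B b0) = (b \in B) && (b != b0).
Proof.
apply/imfsetP/andP => [[c /=]|[bB bb0]]; last by exists b; rewrite //= !inE bb0.
by rewrite !inE => /andP[cb0 cB] /addrI/oppr_inj ->.
Qed.

Lemma big_differences (P : pred 'rV[R]_n) (F : 'rV[R]_n -> 'rV[R]_n) :
  \sum_(v <- differences B b0 | P v) F v =
  \sum_(b <- B | (b != b0) && P (b0 - b)) F (b0 - b).
Proof.
rewrite -big_filter_cond -(big_map (fun b => b0 - b) P F); apply: perm_big.
apply: uniq_perm; rewrite ?fset_uniq // ?map_inj_uniq ?filter_uniq ?fset_uniq //.
  by move=> b c /addrI/oppr_inj.
move=> v; apply/imfsetP/mapP => [] [b bB ->]; exists b => //.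
  by move: bB; rewrite /= !inE mem_filter.
by move: bB; rewrite /= !inE mem_filter.
Qed.

Lemma in_Bbullet v :
  (v \in Bb) = (v \in differences B b0) && has (fun a => same_hyperplane v a) nonorth.
Proof. by rewrite !inE. Qed.

Lemma in_Bcirc v :
  (v \in Bc) = (v \in differences B b0) && ~~ has (fun a => same_hyperplane v a) nonorth.
Proof. by rewrite !inE. Qed.

Lemma in_eq_class (D : {fset 'rV[R]_n}) v w :
  (w \in eq_class D v) = (w \in D) && same_hyperplane v w.
Proof. by rewrite !inE. Qed.

Lemma in_rho a v : a \in nonorth ->
  (v \in rho a) = (v \in differences B b0) && same_hyperplane v a.
Proof.
move=> aN.
have -> : (v \in rho a) = (v \in Bb) && same_hyperplane v a by rewrite !inE.
rewrite in_Bbullet -andbA; congr (_ && _).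
by apply: andb_idl => va; apply/hasP; exists a.
Qed.

Lemma has_same_hyperplane v w (s : seq 'rV[R]_n) : same_hyperplane v w ->
  has (fun a => same_hyperplane v a) s = has (fun a => same_hyperplane w a) s.
Proof. by move=> vw; apply: eq_has => a; exact: same_hyperplane_left. Qed.

Lemma rho_eq_class a v : a \in nonorth -> v \in rho a -> rho a = eq_class Bb v.
Proof.
move=> aN; rewrite in_rho // => /andP[_ va]; apply/fsetP => w.
rewrite in_rho // in_eq_class in_Bbullet -andbA; congr (_ && _).
apply/idP/andP => [wa|[_ vw]]; last first.
  by apply: same_hyperplane_trans va; rewrite same_hyperplane_sym.
split; first by apply/hasP; exists a.
by apply: same_hyperplane_trans va _; rewrite same_hyperplane_sym.
Qed.

Lemma sum_rho a : a \in nonorth ->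
  \sum_(v <- rho a) k (b0 - v) *: v =
  \sum_(b <- B | (b != b0) && same_hyperplane (b0 - b) a) k b *: (b0 - b).
Proof.
move=> aN; transitivity
    (\sum_(v <- differences B b0 | same_hyperplane v a) k (b0 - v) *: v).
  rewrite -[RHS]big_filter; apply: perm_big.
  apply: uniq_perm; rewrite ?filter_uniq ?fset_uniq // => v.
  by rewrite in_rho // mem_filter andbC.
by rewrite big_differences; apply: eq_bigr => b _; rewrite opprB addrC subrK.
Qed.

(** Being proportional to a covector of [nonorth] depends only on the hyperplane, so every
    difference with the hyperplane of [v] lies in [Bc] as well. *)
Lemma sum_eq_class_circ v : v \in Bc ->
  \sum_(b <- B | b0 - b \in eq_class Bc v) k b *: (b - b0) =
  - \sum_(b <- B | (b != b0) && same_hyperplane (b0 - b) v) k b *: (b0 - b).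
Proof.
rewrite in_Bcirc => /andP[_ vN]; rewrite -sumrN big_seq_cond [RHS]big_seq_cond.
apply: eq_big => [b|b _]; last by rewrite -scalerN opprB.
rewrite in_eq_class in_Bcirc in_differences.
have [bB|] //= := boolP (b \in B); rewrite -andbA; congr (_ && _).
rewrite same_hyperplane_sym andb_idl // => /(has_same_hyperplane nonorth) vw.
by rewrite vw.
Qed.

Hypothesis Ap_neq0 : forall a, a \in Ap -> a != 0.
Hypothesis hA_neq0 : forall a, a \in Ap -> hA a != 0.
Hypothesis noncollinear : forall a b, a \in Ap -> b \in Ap ->
  same_hyperplane a b -> a = b.

Lemma sum_same_hyperplane a (c : 'rV[R]_n -> R) : a \in Ap ->
  \sum_(a' <- Ap | same_hyperplane a' a) c a' *: a' = c a *: a.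
Proof.
move=> aA; rewrite big_mkcond (bigD1_seq a aA (fset_uniq _)) /= same_hyperplane_refl.
rewrite big1_seq ?addr0 // => a' /andP[a'a a'A]; case: ifP => // /noncollinear.
by move=> /(_ a'A aA) E; rewrite E eqxx in a'a.
Qed.

Lemma sum_orthogonal a : ~~ has (fun a' => same_hyperplane a a') nonorth ->
  \sum_(a' <- Ap | same_hyperplane a' a) (hA a' * dual_metric A hA h a' b0) *: a' = 0.
Proof.
move=> /hasPn aN; apply: big1_seq => a' /andP[a'a a'A].
have [->|a'0] := eqVneq (dual_metric A hA h a' b0) 0; first by rewrite mulr0 scale0r.
by have := aN a'; rewrite in_nonorthogonal a'A a'0 same_hyperplane_sym a'a => /(_ isT).
Qed.

Lemma residue_conditionP : residue_condition <->
  [/\ rho_bijective A Ap B hA h b0, bullet_residues A Ap B hA h k b0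
    & circ_residues A Ap B hA h k b0].
Proof.
split=> [res|[_ bullet circ] a a0].
  have bullet : bullet_residues A Ap B hA h k b0.
    move=> a aN; move: (aN); rewrite in_nonorthogonal => /andP[aA _].
    rewrite sum_rho // res ?Ap_neq0 //.
    exact: (sum_same_hyperplane (fun a' => hA a' * dual_metric A hA h a' b0)).
  (* An empty [rho a] would force the right-hand side of (ii) to be zero, although both scalar
     factors and [a] itself are non-zero. *)
  have rho_ex a : a \in nonorth -> exists v, v \in rho a.
    move=> aN; move: (aN); rewrite in_nonorthogonal => /andP[aA ab0].
    have [rho0|//] := fset_0Vmem (rho a); last by case=> v; exists v.
    have /eqP := bullet a aN; rewrite rho0 big_seq_fset0 eq_sym scaler_eq0.
    by rewrite mulf_eq0 (negPf ab0) (negPf (hA_neq0 aA)) (negPf (Ap_neq0 aA)).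
  split=> //; last first.
    move=> C /imfsetP[v /= vC ->]; rewrite sum_eq_class_circ //.
    move: vC; rewrite in_Bcirc => /andP[/imfsetP[b /=]].
    rewrite !inE => /andP[bb0 bB] -> vN; rewrite res ?subr_eq0 1?eq_sym //.
    by rewrite sum_orthogonal ?oppr0.
  split.
  - move=> a /= aN; have [v va] := rho_ex a aN.
    rewrite (rho_eq_class aN va); apply/imfsetP; exists v => //=.
    by move: va; rewrite in_rho // in_Bbullet => /andP[-> va]; apply/hasP; exists a.
  - move=> a a'; rewrite !inE /= => aN a'N E; have [v va] := rho_ex a aN.
    have := va; rewrite E in_rho // => /andP[_ va'].
    move: va; rewrite in_rho // => /andP[_ va].
    move: aN a'N; rewrite !in_nonorthogonal => /andP[aA _] /andP[a'A _].
    apply: noncollinear => //; apply: same_hyperplane_trans va'.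
    by rewrite same_hyperplane_sym.
  - move=> C /imfsetP[v /= vB ->]; move: (vB); rewrite in_Bbullet => /andP[vD].
    move=> /hasP[a aN va]; exists a => //; apply: rho_eq_class => //.
    by rewrite in_rho // vD.
(* If the hyperplane of [a] belongs to some [a1] in [nonorth], the claim is (ii) for [a1]. Otherwise
   the right-hand side vanishes, and the left-hand side is either an empty sum or, up to sign, a
   circ residue. *)
have [/hasP[a1 a1N aa1]|aN] :=
    boolP (has (fun a' => same_hyperplane a a') nonorth); last first.
  rewrite sum_orthogonal //.
  have [/hasP[b bB /andP[bb0 ba]]|nB] :=
      boolP (has (fun b => (b != b0) && same_hyperplane (b0 - b) a) B); last first.
    by apply: big1_seq => b /andP[ba bB]; move/hasPn: nB => /(_ b bB); rewrite ba.
  have vC : b0 - b \in Bc.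
    by rewrite in_Bcirc in_differences bB bb0 (has_same_hyperplane _ ba).
  have /circ : eq_class Bc (b0 - b) \in eq_classes Bc by apply/imfsetP; exists (b0 - b).
  rewrite sum_eq_class_circ // => /eqP; rewrite oppr_eq0 => /eqP E; rewrite -[RHS]E.
  apply: eq_bigl => c; rewrite !(same_hyperplane_sym (b0 - c)).
  by rewrite (same_hyperplane_left _ ba).
have a1A : a1 \in Ap by move: a1N; rewrite in_nonorthogonal => /andP[].
transitivity (\sum_(b <- B | (b != b0) && same_hyperplane (b0 - b) a1) k b *: (b0 - b)).
  by apply: eq_bigl => c; rewrite !(same_hyperplane_sym (b0 - c)) (same_hyperplane_left _ aa1).
rewrite -sum_rho // bullet //.
rewrite -(sum_same_hyperplane (fun a' => hA a' * dual_metric A hA h a' b0)) //.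
by apply: eq_bigl => c; rewrite !(same_hyperplane_sym c) (same_hyperplane_left _ aa1).
Qed.

End ResidueConditions.

(** * Separation of the poles in x *)

Lemma symmetrize_sum (R : comPzRingType) (I : Type) (s : seq I) (f : I -> I -> R) :
  2 * \sum_(i <- s) \sum_(j <- s) f i j =
  \sum_(i <- s) \sum_(j <- s) (f i j + f j i).
Proof.
rewrite mulrC mulr2n mulrDr mulr1 {2}exchange_big -big_split; apply: eq_bigr => i _.
by rewrite -big_split.
Qed.

(** Symmetrising is what brings out the factors b - b' in the quadratic terms of both equations; the
    factor 2 avoids a division. *)
Lemma symmetrize_mul_sums (R : comPzRingType) (I : Type) (s : seq I)
    (f g f' g' : I -> R) :
  2 * ((\sum_(i <- s) f i) * (\sum_(i <- s) g i)
       - (\sum_(i <- s) f' i) * (\sum_(i <- s) g' i)) =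
  \sum_(i <- s) \sum_(j <- s) (f i * g j - f' i * g' j + (f j * g i - f' j * g' i)).
Proof.
rewrite -symmetrize_sum !big_distrlr /= -sumrB; congr (_ * _).
by apply: eq_bigr => i _; rewrite -sumrB.
Qed.

(* 1/(u u') = (1/u - 1/u') / (u' - u); the diagonal terms vanish, also on the right
   where they read 0 / 0. *)
Lemma partial_fractions (R : fieldType) (I : eqType) (s : seq I) (k u : I -> R)
    (G : I -> I -> R) :
  (forall i j, G i j = G j i) -> (forall i, G i i = 0) ->
  (forall i, i \in s -> u i != 0) ->
  (forall i j, i \in s -> j \in s -> i != j -> u i != u j) ->
  \sum_(i <- s) \sum_(j <- s) (k i / u i) * (k j / u j) * G i j =
  2 * \sum_(i <- s) k i / u i * \sum_(j <- s) k j * G i j / (u j - u i).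
Proof.
move=> Gsym G0 u0 uinj.
under [X in _ = 2 * X]eq_bigr do rewrite mulr_sumr.
rewrite symmetrize_sum; apply: eq_big_seq => i si; apply: eq_big_seq => j sj.
have [->|ij] := eqVneq i j; first by rewrite !G0 !(mulr0, mul0r) addr0.
have uij : u j - u i != 0 by rewrite subr_eq0 eq_sym uinj.
rewrite (Gsym j i) -(opprB (u j) (u i)); field.
by rewrite oppr_eq0 uij !u0.
Qed.

Section WDVVPoles.
Context {R : realType} {n : nat}.
Variables (A Ap B : {fset 'rV[R]_n}) (hA : 'rV[R]_n -> R) (h : R) (k : 'rV[R]_n -> R).
Implicit Types (a b : 'rV[R]_n) (z : 'cV[R]_n) (p : R * 'cV[R]_n).

Local Notation M := (contracted_const A Ap hA h).

(** The derivative of the left-hand side of the logarithmic identity for [b0]. The term [b = b0] may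
    be included because its numerator is zero. *)
Definition simple_poles b0 z (mu nu : 'I_n) : R :=
  \sum_(b <- B) k b * ((b0 - b) 0 mu * (b0 - b) 0 nu) / pairing (b0 - b) z.

Definition generic z :=
  (forall a, a \in Ap -> pairing a z != 0) /\
  (forall b b', b \in B -> b' \in B -> b != b' -> pairing (b - b') z != 0).

Lemma contracted_constC b z mu nu : M b z mu nu = M b z nu mu.
Proof. by apply: eq_bigr => a _; congr (_ / _); rewrite mulrAC. Qed.

Section Regular.
Variable p : R * 'cV[R]_n.
Hypothesis pB : forall b, b \in B -> ext_pairing b p != 0.
Hypothesis pgen : generic p.2.

Let P b := k b / ext_pairing b p.

Lemma ext_pairing_pole_sum (G : 'rV[R]_n -> 'rV[R]_n -> R) :
  (forall b b', G b b' = G b' b) -> (forall b, G b b = 0) ->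
  \sum_(b <- B) \sum_(b' <- B) P b * P b' * G b b' =
  2 * \sum_(b <- B) P b * \sum_(b' <- B) k b' * G b b' / pairing (b - b') p.2.
Proof.
have uE b b' : ext_pairing b' p - ext_pairing b p = pairing (b - b') p.2.
  by rewrite /ext_pairing pairingBl; ring.
move=> Gsym G0; rewrite partial_fractions // => [|b b' bB b'B bb'].
  by congr (_ * _); apply: eq_bigr => b _; congr (_ * _); apply: eq_bigr => b' _; rewrite uE.
by rewrite -subr_eq0 uE; apply: (pgen.2) => //; rewrite eq_sym.
Qed.

Lemma WDVV2_poles : WDVV2_at A Ap B hA h k p <->
  forall mu nu : 'I_n,
    \sum_(b <- B) P b * (simple_poles b p.2 mu nu - M b p.2 mu nu) = 0.
Proof.
have main mu nu : (\sum_(b <- B) k b / ext_pairing b p)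
      * (\sum_(b <- B) k b * b 0 mu * b 0 nu / ext_pairing b p)
    - (\sum_(b <- B) k b * b 0 mu / ext_pairing b p)
      * (\sum_(b <- B) k b * b 0 nu / ext_pairing b p)
    = \sum_(b <- B) P b * simple_poles b p.2 mu nu.
  apply: (@mulfI _ 2); first by rewrite pnatr_eq0.
  rewrite -(ext_pairing_pole_sum
    (G := fun b b' => (b - b') 0 mu * (b - b') 0 nu)); first last.
  - by move=> b; rewrite subrr mxE mul0r.
  - by move=> b b'; rewrite !mxE; ring.
  rewrite symmetrize_mul_sums; apply: eq_bigr => b _; apply: eq_bigr => b' _.
  by rewrite /P !mxE; ring.
have split_sum mu nu : \sum_(b <- B) P b * (simple_poles b p.2 mu nu - M b p.2 mu nu) =
    \sum_(b <- B) P b * simple_poles b p.2 mu nu - \sum_(b <- B) P b * M b p.2 mu nu.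
  by rewrite -sumrB; apply: eq_bigr => b _; rewrite mulrBr.
split=> H mu nu; have := H mu nu; rewrite split_sum -main => /eqP;
  rewrite -subr_eq0 => /eqP {}H; apply/eqP; rewrite -subr_eq0; apply/eqP;
  rewrite -[RHS]H; rewrite /P; ring.
Qed.

Lemma WDVV1_of_residues :
  (forall b mu nu, b \in B -> simple_poles b p.2 mu nu = M b p.2 mu nu) ->
  WDVV1_at A Ap B hA h k p.
Proof.
move=> E mu nu rho.
have main : (\sum_(b <- B) k b * b 0 rho / ext_pairing b p)
      * (\sum_(b <- B) k b * b 0 mu * b 0 nu / ext_pairing b p)
    - (\sum_(b <- B) k b * b 0 mu / ext_pairing b p)
      * (\sum_(b <- B) k b * b 0 nu * b 0 rho / ext_pairing b p)
    = \sum_(b <- B) P b * (b 0 rho * M b p.2 mu nu - b 0 mu * M b p.2 nu rho).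
  apply: (@mulfI _ 2); first by rewrite pnatr_eq0.
  (* The bracket equals b_mu b'_rho - b'_mu b_rho, antisymmetric like (b - b')_nu, so [G] is
     symmetric. This form displays it as a combination of numerators of [simple_poles b] with
     coefficients depending on [b] only. *)
  pose G (b b' : 'rV[R]_n) :=
    ((b - b') 0 mu * b 0 rho - (b - b') 0 rho * b 0 mu) * (b - b') 0 nu.
  transitivity (\sum_(b <- B) \sum_(b' <- B) P b * P b' * G b b').
    rewrite symmetrize_mul_sums; apply: eq_bigr => b _; apply: eq_bigr => b' _.
    by rewrite /P /G !mxE; ring.
  rewrite ext_pairing_pole_sum; first last.
  - by move=> b; rewrite /G subrr !mxE; ring.
  - by move=> b b'; rewrite /G !mxE; ring.
  congr (_ * _); apply: eq_big_seq => b bB; congr (_ * _).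
  rewrite (contracted_constC _ _ nu) -!E // /simple_poles !mulr_sumr -sumrB.
  by apply: eq_bigr => b' _; rewrite /G; ring.
apply/eqP; rewrite -subr_eq0; apply/eqP.
transitivity (\sum_(b <- B) P b * (b 0 rho * M b p.2 mu nu - b 0 mu * M b p.2 nu rho)
  - \sum_(b <- B) P b * (b 0 rho * M b p.2 mu nu - b 0 mu * M b p.2 nu rho));
  last by rewrite subrr.
rewrite -{2}main; set X := \sum_(b <- B) P b * _.
have -> : X = \sum_(b <- B) k b * b 0 rho / ext_pairing b p * M b p.2 mu nu -
    \sum_(b <- B) k b * b 0 mu / ext_pairing b p * M b p.2 nu rho.
  by rewrite -sumrB; apply: eq_bigr => b _; rewrite /P; ring.
ring.
Qed.

End Regular.

Hypothesis k_neq0 : forall b, b \in B -> k b != 0.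

(* Letting x tend to b1(z) isolates the pole of index b1. *)
Lemma residues_of_WDVV2 z : generic z ->
  (forall x, (forall b, b \in B -> ext_pairing b (x, z) != 0) ->
     WDVV2_at A Ap B hA h k (x, z)) ->
  forall b mu nu, b \in B -> simple_poles b z mu nu = M b z mu nu.
Proof.
move=> zgen W b1 mu nu b1B.
pose c b := k b * (simple_poles b z mu nu - M b z mu nu).
have p0 b : b \in B -> (pairing (b1 - b) z == 0) = (b == b1).
  move=> bB; apply/idP/eqP => [|->]; last by rewrite subrr /pairing mul0mx mxE.
  by apply: contraTeq => bb1; apply: (zgen.2) => //; rewrite eq_sym.
have uE b t : ext_pairing b (pairing b1 z + t, z) = pairing (b1 - b) z + t * 1.
  by rewrite /ext_pairing /= pairingBl; ring.
have : \sum_(b <- B | pairing (b1 - b) z == 0) c b / 1 = 0.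
  apply: (residue_eq0 (p := fun b => pairing (b1 - b) z) (q := fun=> 1)).
    by move=> b _ _; exact: oner_neq0.
  have H b : b \in B -> \forall t \near (0 : R)^', pairing (b1 - b) z + t * 1 != 0.
    by move=> _; apply: dnbhs_affine_neq0; rewrite oner_neq0.
  apply: filterS (near_all_in H) => t tB.
  have xB b : b \in B -> ext_pairing b (pairing b1 z + t, z) != 0.
    by move=> bB; rewrite uE tB.
  rewrite -[RHS]((WDVV2_poles xB zgen).1 (W _ xB) mu nu).
  by apply: eq_bigr => b _; rewrite uE /c /=; ring.
rewrite big_seq_cond (eq_bigl (fun b => (b \in B) && (b == b1))); last first.
  by move=> b; case bB: (b \in B) => //=; rewrite p0.
rewrite -big_seq_cond big_mkcond (bigD1_seq b1 b1B (fset_uniq _)) /= eqxx.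
rewrite big1 ?addr0 => [|b /negPf -> //].
by move/eqP; rewrite divr1 mulf_eq0 (negPf (k_neq0 b1B)) subr_eq0 => /eqP.
Qed.

(** Left-hand side minus right-hand side of the identity as one list of weighted covectors. It is a
    sequence because a difference [b0 - b] may coincide with an element of [Ap]. *)
Let covector_data b0 : seq (R * 'rV[R]_n) :=
  [seq (k b, b0 - b) | b <- [seq b <- B | b != b0]] ++
  [seq (- (hA a * dual_metric A hA h a b0), a) | a <- Ap].

Let covector_dataP b0 i : i \in covector_data b0 ->
  (exists2 b, b \in B /\ b != b0 & i.2 = b0 - b) \/ i.2 \in Ap.
Proof.
rewrite mem_cat => /orP[/mapP[b]|/mapP[a aA ->]]; last by right.
by rewrite mem_filter => /andP[bb0 bB] ->; left; exists b.
Qed.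

Let sum_covector_data b0 z mu nu :
  \sum_(i <- covector_data b0) i.1 * i.2 0 mu * i.2 0 nu / pairing i.2 z =
  simple_poles b0 z mu nu - M b0 z mu nu.
Proof.
rewrite big_cat !big_map big_filter -sumrN; congr (_ + _).
  rewrite big_mkcond; apply: eq_bigr => b _ /=; case: eqVneq => [->|_] /=.
    by rewrite subrr mxE !(mul0r, mulr0).
  by rewrite mulrA.
by apply: eq_bigr => a _ /=; ring.
Qed.

Let residues_covector_data b0 a :
  \sum_(i <- covector_data b0 | same_hyperplane i.2 a) i.1 *: i.2 = 0 <->
  \sum_(b <- B | (b != b0) && same_hyperplane (b0 - b) a) k b *: (b0 - b) =
  \sum_(a' <- Ap | same_hyperplane a' a) (hA a' * dual_metric A hA h a' b0) *: a'.
Proof.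
rewrite big_cat !big_map big_filter_cond /=.
under [X in _ + X]eq_bigr do rewrite scaleNr.
by rewrite sumrN; split=> [/subr0_eq|->]; rewrite ?subrr.
Qed.

Let walls : seq 'rV[R]_n :=
  Ap ++ [seq v <- [seq b - b' | b <- B, b' <- B] | v != 0].

Let walls_generic z : (forall w, w \in walls -> pairing w z != 0) <-> generic z.
Proof.
split=> [H|[zA zB] w].
  split=> [a aA|b b' bB b'B bb']; apply: H; rewrite mem_cat ?aA //.
  apply/orP; right; rewrite mem_filter subr_eq0 bb' /=.
  by apply/allpairsP; exists (b, b').
rewrite mem_cat mem_filter => /orP[/zA //|/andP[w0 /allpairsP[[b b'] /= [bB b'B E]]]].
by rewrite E; apply: zB => //; rewrite -subr_eq0 -E.
Qed.

Hypothesis Ap_neq0 : forall a, a \in Ap -> a != 0.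

Let walls_neq0 : 0 \notin walls.
Proof.
rewrite mem_cat mem_filter eqxx orbF; apply/negP => /Ap_neq0.
by rewrite eqxx.
Qed.

(** Both directions are the two residue lemmas applied to [covector_data b0], whose covectors all
    lie in [walls] and hence do not vanish at generic points. *)
Lemma residue_conditionE b0 : b0 \in B ->
  residue_condition A Ap B hA h k b0 <->
  forall z, generic z -> forall mu nu, simple_poles b0 z mu nu = M b0 z mu nu.
Proof.
move=> b0B; split=> [res z zgen mu nu|E a a0].
  apply: subr0_eq; rewrite -sum_covector_data; apply: identity_of_residues.
    move=> i /covector_dataP[[b [bB bb0] ->]|/(zgen.1) //].
    by apply: (zgen.2) => //; rewrite eq_sym.
  by move=> a a0; apply/residues_covector_data/res.
apply/residues_covector_data; apply: (residue_of_identity (s' := walls)) => //.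
  move=> w /mapP[i /covector_dataP[[b [bB bb0]]|iA] ->]; last by rewrite mem_cat iA.
  move=> ->; rewrite mem_cat; apply/orP; right; rewrite mem_filter subr_eq0 eq_sym bb0.
  by apply/allpairsP; exists (b0, b).
move=> z /walls_generic zgen mu nu.
by rewrite sum_covector_data E // subrr.
Qed.

Lemma exists_generic : exists z, generic z.
Proof.
have [|||z [_ zP]] := @exists_avoiding R n setT walls; rewrite //.
  move=> w ww; have [y wy] := @exists_pairing1 R n w (memPn walls_neq0 w ww).
  by exists y; rewrite wy oner_neq0.
by exists z; apply/walls_generic.
Qed.

(** * Extension to non-generic regular points by continuity *)

Section Continuity.
Variables (p : R * 'cV[R]_n) (y : 'cV[R]_n).
Hypothesis pA : forall a, a \in Ap -> pairing a p.2 != 0.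
Hypothesis pB : forall b, b \in B -> ext_pairing b p != 0.

Let line t : R * 'cV[R]_n := (p.1, p.2 + t *: y).

Let ext_pairing_line b t : ext_pairing b (line t) = ext_pairing b p + t * - pairing b y.
Proof. by rewrite /ext_pairing /= pairingDr pairingZr; ring. Qed.

Let cvg_pole_sum (c : 'rV[R]_n -> R) :
  \sum_(b <- B) c b / ext_pairing b (line t) @[t --> (0 : R)] -->
  \sum_(b <- B) c b / ext_pairing b p.
Proof.
apply: cvg_bigsum_in => b bB; under eq_fun do rewrite ext_pairing_line.
by apply: cvg_div_affine; exact: pB.
Qed.

Let cvg_contracted_const b mu nu :
  M b (line t).2 mu nu @[t --> (0 : R)] --> M b p.2 mu nu.
Proof.
apply: cvg_bigsum_in => a aA; under eq_fun do rewrite /= pairingDr pairingZr.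
by apply: cvg_div_affine; exact: pA.
Qed.

Let cvg_pole_contracted_sum (c : 'rV[R]_n -> R) mu nu :
  \sum_(b <- B) c b / ext_pairing b (line t) * M b (line t).2 mu nu @[t --> (0 : R)] -->
  \sum_(b <- B) c b / ext_pairing b p * M b p.2 mu nu.
Proof.
apply: cvg_bigsum_in => b bB; apply: cvgM; last exact: cvg_contracted_const.
under eq_fun do rewrite ext_pairing_line.
by apply: cvg_div_affine; exact: pB.
Qed.

(** All denominators are non-zero at [p], so both sides of each equation are continuous at t = 0
    along the line. *)
Lemma WDVV_at_limit :
  (\forall t \near (0 : R)^',
     WDVV1_at A Ap B hA h k (line t) /\ WDVV2_at A Ap B hA h k (line t)) ->
  WDVV1_at A Ap B hA h k p /\ WDVV2_at A Ap B hA h k p.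
Proof.
pose L1 q (mu nu rho : 'I_n) :=
  \sum_(b <- B) k b * b 0 rho / ext_pairing b q * M b q.2 mu nu
  - (\sum_(b <- B) k b * b 0 rho / ext_pairing b q)
      * (\sum_(b <- B) k b * b 0 mu * b 0 nu / ext_pairing b q).
pose L2 q (mu nu : 'I_n) :=
  - \sum_(b <- B) k b / ext_pairing b q * M b q.2 mu nu
  + (\sum_(b <- B) k b / ext_pairing b q)
      * (\sum_(b <- B) k b * b 0 mu * b 0 nu / ext_pairing b q).
pose R2 q (mu nu : 'I_n) := (\sum_(b <- B) k b * b 0 mu / ext_pairing b q)
  * (\sum_(b <- B) k b * b 0 nu / ext_pairing b q).
have L1_cvg mu nu rho : L1 (line t) mu nu rho @[t --> (0 : R)] --> L1 p mu nu rho.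
  apply: cvgB; first exact: (@cvg_pole_contracted_sum (fun b => k b * b 0 rho)).
  apply: cvgM; first exact: (@cvg_pole_sum (fun b => k b * b 0 rho)).
  exact: (@cvg_pole_sum (fun b => k b * b 0 mu * b 0 nu)).
have L2_cvg mu nu : L2 (line t) mu nu @[t --> (0 : R)] --> L2 p mu nu.
  apply: cvgD; first by apply: cvgN; exact: (@cvg_pole_contracted_sum k).
  apply: cvgM; first exact: (@cvg_pole_sum k).
  exact: (@cvg_pole_sum (fun b => k b * b 0 mu * b 0 nu)).
have R2_cvg mu nu : R2 (line t) mu nu @[t --> (0 : R)] --> R2 p mu nu.
  apply: cvgM; first exact: (@cvg_pole_sum (fun b => k b * b 0 mu)).
  exact: (@cvg_pole_sum (fun b => k b * b 0 nu)).
move=> W; split=> [mu nu rho|mu nu]; apply: subr0_eq.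
  have K : L1 (line t) mu nu rho - L1 (line t) nu rho mu @[t --> (0 : R)] -->
      L1 p mu nu rho - L1 p nu rho mu by apply: cvgB; exact: L1_cvg.
  apply: (cvg_eq0 K); apply: filterS W => t [W1 _].
  by apply/eqP; rewrite subr_eq0; apply/eqP; exact: W1.
have K : L2 (line t) mu nu - R2 (line t) mu nu @[t --> (0 : R)] -->
    L2 p mu nu - R2 p mu nu by apply: cvgB; [exact: L2_cvg|exact: R2_cvg].
apply: (cvg_eq0 K); apply: filterS W => t [_ W2].
by apply/eqP; rewrite subr_eq0; apply/eqP; exact: W2.
Qed.

End Continuity.

Lemma WDVV_atE :
  (forall p, regular_points Ap B p ->
     WDVV1_at A Ap B hA h k p /\ WDVV2_at A Ap B hA h k p) <->
  forall b, b \in B -> residue_condition A Ap B hA h k b.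
Proof.
split=> [W b bB|res p [pA pB]].
  apply/residue_conditionE => // z zgen mu nu.
  by apply: residues_of_WDVV2 => // x xB; apply: (W (x, z) _).2; split=> //; exact: zgen.1.
have E z : generic z -> forall b mu nu, b \in B -> simple_poles b z mu nu = M b z mu nu.
  by move=> zgen b mu nu bB; apply: ((residue_conditionE bB).1 (res b bB)).
have Wgen q : (forall b, b \in B -> ext_pairing b q != 0) -> generic q.2 ->
    WDVV1_at A Ap B hA h k q /\ WDVV2_at A Ap B hA h k q.
  move=> qB qgen; split; first by apply: WDVV1_of_residues => // b mu nu; exact: E.
  apply/WDVV2_poles => // mu nu; apply: big1_seq => b /andP[_ bB].
  by rewrite E // subrr mulr0.
have [y /walls_generic ygen] := exists_generic.
(* The direction [y] is itself generic: a wall through [p.2] takes the value t w(y), non-zero for t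
   != 0, so the line leaves all walls at once while x stays fixed. *)
apply: (WDVV_at_limit (y := y)) => //.
have Hw w : w \in walls ->
    \forall t \near (0 : R)^', pairing w p.2 + t * pairing w y != 0.
  by move=> ww; apply: dnbhs_affine_neq0 => _; exact: ygen.
have HB b : b \in B ->
    \forall t \near (0 : R)^', ext_pairing b p + t * - pairing b y != 0.
  by move=> bB; apply: dnbhs_affine_neq0 => /eqP b0; have := pB b bB; rewrite -/(ext_pairing b p) b0 eqxx.
apply: filterS2 (near_all_in Hw) (near_all_in HB) => t tw tB; apply: Wgen => [b bB|].
  have := tB b bB; rewrite /ext_pairing /= pairingDr pairingZr.
  by rewrite mulrN opprD addrA.
by apply/walls_generic => w ww; rewrite /= pairingDr pairingZr tw.
Qed.

End WDVVPoles.

(** [noncollinear] makes [rho] injective and leaves a single covector of [Ap] in each residue;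
    [hA_neq0] makes every [rho a] non-empty; [k_neq0] allows the factor [k b] to be cancelled from
    the pole at x = b(z). *)
Theorem mainTheorem1 (R : realType) (n : nat)
    (A Ap B : {fset 'rV[R]_n}) (hA : 'rV[R]_n -> R) (h : R)
    (k : 'rV[R]_n -> R)
    (veeA : vee_system A hA h)
    (posAp : positive_subsystem A Ap)
    (noncollinear : forall a b, a \in Ap -> b \in Ap ->
       same_hyperplane a b -> a = b)
    (hA_neq0 : forall a, a \in A -> hA a != 0)
    (k_neq0 : forall b, b \in B -> k b != 0)
    (centre_of_mass : \sum_(b <- B) k b *: b = 0) :
  open_WDVV (gram A hA h) (closed_prepotential Ap hA) (open_prepotential B k)
    (regular_points Ap B)
  <-> open_vee_system A Ap B hA h k.
Proof.
have ApA a : a \in Ap -> a \in A by have [/fsubsetP ApA _] := posAp => /ApA.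
have Ap_neq0 a : a \in Ap -> a != 0 by move=> /ApA; exact: vee_neq0 veeA a.
have hAp_neq0 a : a \in Ap -> hA a != 0 by move=> /ApA; exact: hA_neq0.
have resP b := residue_conditionP A B h k b Ap_neq0 hAp_neq0 noncollinear.
have wdvvE := WDVV_atE A hA h k_neq0 Ap_neq0.
have regE p : regular_points Ap B p ->
    (open_WDVV1 (gram A hA h) (closed_prepotential Ap hA) (open_prepotential B k) p <->
     WDVV1_at A Ap B hA h k p) /\
    (open_WDVV2 (gram A hA h) (closed_prepotential Ap hA) (open_prepotential B k) p <->
     WDVV2_at A Ap B hA h k p).
  by move=> [pA pB]; apply: open_WDVVE.
split=> [W b bB|V].
  apply/resP; apply: (wdvvE.1 _ b bB) => p reg.
  have [E1 E2] := regE p reg; have [W1 W2] := W p reg.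
  by split; [exact/E1|exact/E2].
have W : forall b, b \in B -> residue_condition A Ap B hA h k b.
  by move=> b bB; apply/resP; exact: V.
move=> p reg; have [E1 E2] := regE p reg.
have [W1 W2] := wdvvE.2 W p reg.
by split; [exact/E1|exact/E2].
Qed.
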